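(* Let $n\ge 1$. For every standard Young tableau $T\in \mathrm{SYT}(n)$, the number of $p\in \mathrm{OWP}_n$ with $\phi(p)=T$ is $$\#\phi^{-1}(T)=\prod_{i=1}^n\sigma_i(T),$$ where $$\sigma_i(T)=\begin{cases} i-\mathrm{col}_1(T_i)+1, & \text{if } i \text{ is in the first column of } T,\\ \mathrm{col}_k(T_i)-\mathrm{col}_{k+1}(T_i)+1, & \text{if } i \text{ is in the } (k+1)\text{-th column of } T,\ k\ge 1.\end{cases}$$ Hence, for a smooth function $c=c(x)$ and $D=\frac{\mathrm d}{\mathrm dx}$, with $c_i=D^i c$, $$(cD)^n c=\sum_{T\in \mathrm{SYT}(n)}\#\phi^{-1}(T)\,c^{\,n+1-\ell(\lambda(T))}\prod_{i=1}^n c_i^{w_i(T)}=\sum_{T\in \mathrm{SYT}(n)}\left(\prod_{i=1}^n\sigma_i(T)\,c_i^{w_i(T)}\right)c^{\,n+1-\ell(\lambda(T))}.$$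
   Context: Tableaux. A standard Young tableau of size $n$ is a filling of the Ferrers diagram of a partition $\lambda\vdash n$ (French convention: left-justified rows, numbered from bottom to top, with $\lambda_i$ boxes in row $i$) with $1,\dots,n$, each used exactly once, increasing from left to right in rows and from bottom to top in columns. $\mathrm{SYT}(n)$ is the set of all of them, over all shapes $\lambda\vdash n$. For $T\in\mathrm{SYT}(n)$: $\ell(\lambda(T))$ is the number of (nonempty) rows of $T$; $w_i(T)$ is the number of rows of $T$ with exactly $i$ boxes; $T_i\in \mathrm{SYT}(i)$ is obtained from $T$ by deleting the entries $i+1,\dots,n$; $\mathrm{col}_k(T_i)$ is the number of boxes in the $k$-th column of $T_i$. Ordered weak set partitions. $\mathrm{OWP}_n$ is the set of lists $(B_0,B_1,\dots,B_n)$ of pairwise disjoint (possibly empty) subsets of $[n]=\{1,\dots,n\}$ with union $[n]$ such that (a) $1\in B_0$; (b) for $1\le i\le n$, if $B_i$ is nonempty then its minimum is larger than $i$. The map $\phi:\mathrm{OWP}_n\to\mathrm{SYT}(n)$. Given $p=(B_0,\dots,B_n)$, write the elements of each block as a left-justified row in increasing order; reorder the rows by length, decreasing from bottom to top, and delete the empty ones; then rearrange the entries of each column in ascending order from bottom to top. The result is $\phi(p)$. Write $\phi^{-1}(T)=\{p\in\mathrm{OWP}_n:\phi(p)=T\}$. $(cD)^n c$ denotes the result of applying $n$ times to the function $c$ the operator $f\mapsto c\cdot f'$. *)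

(* Defs.v *)
From HB Require Import structures.
From mathcomp Require Import all_boot all_order all_algebra.
From mathcomp Require Import all_classical all_reals all_analysis.
Import numFieldNormedType.Exports.

Set Implicit Arguments.
Unset Strict Implicit.
Unset Printing Implicit Defensive.

(* A filling of a Ferrers diagram (French convention) is the list of its      *)
(* rows from bottom to top, each row being read from left to right.           *)
Notation filling := (seq (seq nat)).

(* Columns are numbered from 1; [column 0 t] is meaningless.  When the row    *)
(* lengths are weakly decreasing, [column k t] lists the k-th column from     *)
(* bottom to top, without gaps.                                               *)
Definition column (k : nat) (t : filling) : seq nat :=
  [seq nth 0 r k.-1 | r <- t & k <= size r].

Definition col (k : nat) (t : filling) : nat := size (column k t).

Definition is_syt (n : nat) (t : filling) : bool :=
  [&& [::] \notin t, sorted geq [seq size r | r <- t],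
      perm_eq (flatten t) (iota 1 n), all (sorted ltn) t &
      all (fun k => sorted ltn (column k t)) (iota 1 n)].

Definition unnil (t : filling) : filling := [seq r <- t | r != [::]].

Definition restrict (i : nat) (t : filling) : filling :=
  unnil [seq [seq x <- r | x <= i] | r <- t].

Definition nrows (t : filling) : nat := size t.

Definition nrows_of_size (i : nat) (t : filling) : nat :=
  count (fun r => size r == i) t.

Definition column_of (x : nat) (t : filling) : nat :=
  (index x (nth [::] t (find (fun r => x \in r) t))).+1.

(* Subtraction is truncated, but every difference below is nonnegative on     *)
(* tableaux.                                                                  *)
Definition sigma (i : nat) (t : filling) : nat :=
  let ti := restrict i t in
  let j := column_of i t in
  if j == 1 then i - col 1 ti + 1 else col j.-1 ti - col j ti + 1.

(* Entries 1, ..., n are represented in 'I_n.+1 by the ordinals of the same   *)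
(* value (ord0 never occurs); a tableau of size n has at most n rows, of at   *)
(* most n boxes each, so the bounds only serve to make the type finite.       *)
Notation bfilling n := (n.-bseq (n.-bseq 'I_n.+1)).

Definition rows_of_bfilling n (t : bfilling n) : filling :=
  [seq [seq nat_of_ord x | x <- (r : n.-bseq 'I_n.+1)]
     | r <- (t : bfilling n)].

Definition SYT (n : nat) : predArgType :=
  {t : bfilling n | is_syt n (rows_of_bfilling t)}.

Coercion syt_rows n (T : SYT n) : filling := rows_of_bfilling (val T).

Definition elements n (b : {set 'I_n.+1}) : seq nat :=
  sort leq [seq nat_of_ord x | x <- enum b].

Definition is_owp n (B : {ffun 'I_n.+1 -> {set 'I_n.+1}}) : bool :=
  [&& [forall i, forall j, (i != j) ==> [disjoint B i & B j]],
      \bigcup_i B i == [set x : 'I_n.+1 | 0 < x],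
      1 \in elements (B ord0) &
      [forall i : 'I_n.+1, (0 < i) ==> [forall x in B i, i < x]]].

Definition OWP (n : nat) : predArgType :=
  {B : {ffun 'I_n.+1 -> {set 'I_n.+1}} | is_owp B}.

Definition blocks n (p : OWP n) : {ffun 'I_n.+1 -> {set 'I_n.+1}} := val p.

(* Ties in length may be broken arbitrarily: the result of [sort_columns]     *)
(* does not depend on the order of rows of equal length.                      *)
Definition sort_rows (t : filling) : filling :=
  sort (fun r s => size s <= size r) t.

Definition sort_columns (t : filling) : filling :=
  [seq [seq nth 0 (sort leq (column j t)) a
          | j <- iota 1 (size (nth [::] t a))]
     | a <- iota 0 (size t)].

Definition phi_rows n (p : OWP n) : filling :=
  sort_columns (sort_rows (unnil [seq elements (blocks p i) | i <- enum 'I_n.+1])).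

(* Up to [phi_rows_syt]: [phi_rows p] is a standard Young tableau.            *)
Lemma column_cons k r t :
  column k (r :: t) = (if k <= size r then [:: nth 0 r k.-1] else [::]) ++ column k t.
Proof. by rewrite /column /=; case: ifP. Qed.

Lemma count_row x (r : seq nat) N : size r <= N ->
  \sum_(1 <= k < N.+1) ((k <= size r) && (nth 0 r k.-1 == x)) = count_mem x r.
Proof.
move=> le_rN; rewrite (@big_cat_nat _ _ _ (size r).+1) //=.
rewrite [X in _ + X]big_nat_cond [X in _ + X]big1 ?addn0; last first.
  by move=> k /andP[/andP[ltk _] _]; rewrite leqNgt ltk.
rewrite big_add1 /= -sum1_count [RHS]big_mkcond [RHS](big_nth 0) /=.
rewrite big_nat_cond [RHS]big_nat_cond; apply: eq_bigr => i; rewrite andbT => /andP[_ lti].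
by rewrite lti; case: (_ == x).
Qed.

Lemma count_columns x (t : filling) N : all (fun r => size r <= N) t ->
  count_mem x (flatten t) = \sum_(1 <= k < N.+1) count_mem x (column k t).
Proof.
elim: t => [|r t IHt] /=; first by rewrite big1.
case/andP=> le_rN /IHt{}IHt; rewrite count_cat IHt -(count_row x le_rN) -big_split /=.
apply: eq_bigr => k _; rewrite column_cons count_cat.
by case: ifP => //= _; rewrite addn0.
Qed.

Lemma size_sort_columns t : size (sort_columns t) = size t.
Proof. by rewrite size_map size_iota. Qed.

Lemma shape_sort_columns t : [seq size r | r <- sort_columns t] = [seq size r | r <- t].
Proof.
apply: (@eq_from_nth _ 0); rewrite !size_map size_iota // => i lti.
rewrite -map_comp (nth_map 0) ?size_iota // nth_iota // add0n /= size_map size_iota.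
by rewrite (nth_map [::]).
Qed.

Definition young (t : filling) := sorted geq [seq size r | r <- t].

Lemma youngP t : young t -> forall a b, a <= b -> b < size t ->
  size (nth [::] t b) <= size (nth [::] t a).
Proof.
move=> yt a b le_ab ltb.
have geqT : transitive geq by move=> x y z le1 le2; exact: leq_trans le2 le1.
have geqR : reflexive geq by move=> x; exact: leqnn.
have := sorted_leq_nth geqT geqR 0 yt.
move/(_ a b); rewrite !inE !size_map (leq_ltn_trans le_ab ltb) ltb => /(_ isT isT le_ab).
by rewrite !(nth_map [::]) // (leq_ltn_trans le_ab).
Qed.

(* In a Young shape, the rows meeting column k come first. *)
Lemma young_filter t k : young t ->
  [seq r <- t | k <= size r] = take (count (fun r => k <= size r) t) t.
Proof.
elim: t => //= r t IHt yrt.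
have yt : young t by apply: path_sorted yrt.
case: ifP => lek /=; first by rewrite IHt.
have -> : count (fun r => k <= size r) t = 0.
  apply/eqP; rewrite -leqn0 leqNgt -has_count; apply/negP => /hasP[s st les].
  have geqT : transitive geq by move=> x y z le1 le2; exact: leq_trans le2 le1.
  move: yrt; rewrite /young /= (path_sortedE geqT) => /andP[/allP /(_ (size s))].
  by move=> /(_ (map_f _ st)) /= le_sr _; rewrite (leq_trans les le_sr) in lek.
apply/eqP; rewrite addn0 take0 -size_eq0 size_filter -leqn0 leqNgt -has_count.
apply/negP => /hasP[s st les].
have geqT : transitive geq by move=> x y z le1 le2; exact: leq_trans le2 le1.
move: yrt; rewrite /young /= (path_sortedE geqT) => /andP[/allP /(_ (size s))].
by move=> /(_ (map_f _ st)) /= le_sr _; rewrite (leq_trans les le_sr) in lek.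
Qed.

Lemma size_column k t : size (column k t) = count (fun r => k <= size r) t.
Proof. by rewrite size_map size_filter. Qed.

Lemma nth_column k t a : young t -> a < size (column k t) ->
  nth 0 (column k t) a = nth 0 (nth [::] t a) k.-1.
Proof.
rewrite size_column => yt lta; rewrite /column young_filter //.
rewrite (nth_map [::]) ?nth_take // size_take.
by case: ifP => // _; apply: leq_trans lta (count_size _ _).
Qed.

Lemma ltn_size_column k t a : young t -> a < size t ->
  (a < size (column k t)) = (k <= size (nth [::] t a)).
Proof.
move=> yt lta; apply/idP/idP => [|le_k].
  rewrite size_column => lta'.
  have : nth [::] t a \in [seq r <- t | k <= size r].
    rewrite young_filter // -(nth_take [::] lta'); apply: mem_nth; rewrite size_take.
    by case: ifP.
  by rewrite mem_filter => /andP[].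
rewrite size_column -{1}(cat_take_drop a.+1 t) count_cat.
suff -> : count (fun r => k <= size r) (take a.+1 t) = a.+1 by rewrite addSn ltnS leq_addr.
have sz : size (take a.+1 t) = a.+1 by rewrite size_takel.
rewrite -[RHS]sz; apply/eqP; rewrite -all_count; apply/(all_nthP [::]) => i.
rewrite sz ltnS => le_ia; rewrite nth_take //.
exact: leq_trans le_k (youngP yt le_ia lta).
Qed.

Lemma young_sort_columns t : young t -> young (sort_columns t).
Proof. by rewrite /young shape_sort_columns. Qed.

Lemma nth_sort_columns t a k : a < size t -> 0 < k <= size (nth [::] t a) ->
  nth 0 (nth [::] (sort_columns t) a) k.-1 = nth 0 (sort leq (column k t)) a.
Proof.
case: k => // k lta /= ltk.
rewrite /sort_columns (nth_map 0) ?size_iota // nth_iota // add0n.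
by rewrite (nth_map 0) ?size_iota // nth_iota.
Qed.

Lemma column_sort_columns k t : 0 < k -> young t ->
  column k (sort_columns t) = sort leq (column k t).
Proof.
move=> k0 yt; have yt' := young_sort_columns yt.
have szE : size (column k (sort_columns t)) = size (column k t).
  rewrite !size_column -!(count_map size (fun m => k <= m)).
  by rewrite shape_sort_columns.
apply: (@eq_from_nth _ 0); rewrite ?size_sort // => a lta.
rewrite nth_column //; rewrite szE in lta.
have lta' : a < size t.
  by rewrite (leq_trans lta) // size_column count_size.
by rewrite nth_sort_columns // k0 -ltn_size_column.
Qed.

Lemma count_column_shift k t v : 0 < k -> all (sorted ltn) t ->
  count (fun y => y <= v) (column k.+1 t) <= count (fun y => y < v) (column k t).
Proof.
move=> k0; elim: t => //= r t IHt /andP[sr /IHt{}IHt].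
rewrite !column_cons !count_cat; apply: leq_add => //.
case: ifP => // lek; rewrite (ltnW lek) /= !addn0.
have lt_r : nth 0 r k.-1 < nth 0 r k.
  apply: (sorted_ltn_nth ltn_trans 0 sr); rewrite ?inE ?ltn_predL //.
  by rewrite (leq_ltn_trans (leq_pred k)).
by case: (leqP (nth 0 r k) v) => // /(leq_trans lt_r) ->.
Qed.

Lemma sorted_count_lt (s : seq nat) a v : sorted leq s ->
  a < count (fun y => y < v) s -> nth 0 s a < v.
Proof.
move=> ss lta; rewrite ltnNge; apply/negP => le_v.
have lts : a < size s := leq_trans lta (count_size _ _).
move: lta; apply/negP; rewrite -leqNgt -{1}(cat_take_drop a s) count_cat.
have -> : count (fun y => y < v) (drop a s) = 0.
  apply/eqP; rewrite -leqn0 leqNgt -has_count; apply/negP => /(has_nthP 0)[i].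
  rewrite size_drop nth_drop => lti; rewrite ltnNge => /negP; apply.
  apply: leq_trans le_v _; apply: (sorted_leq_nth leq_trans leqnn 0 ss).
  - by rewrite inE.
  - by rewrite inE -ltn_subRL.
  - by rewrite leq_addr.
by rewrite addn0 (leq_trans (count_size _ _)) // size_take_min geq_minl.
Qed.

Lemma sorted_count_le (s : seq nat) a : sorted leq s -> a < size s ->
  a < count (fun y => y <= nth 0 s a) s.
Proof.
move=> ss lta; rewrite -{2}(cat_take_drop a.+1 s) count_cat.
suff -> : count (fun y => y <= nth 0 s a) (take a.+1 s) = a.+1.
  by rewrite addSn ltnS leq_addr.
have sz : size (take a.+1 s) = a.+1 by rewrite size_takel.
rewrite -[RHS]sz; apply/eqP; rewrite -all_count; apply/(all_nthP 0) => i.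
rewrite sz ltnS => le_ia; rewrite nth_take //.
apply: (sorted_leq_nth leq_trans leqnn 0 ss) => //; rewrite inE //.
exact: leq_ltn_trans le_ia lta.
Qed.

Lemma sort_columns_syt n t : [::] \notin t -> young t -> perm_eq (flatten t) (iota 1 n) ->
  all (sorted ltn) t -> is_syt n (sort_columns t).
Proof.
move=> t0 yt pt st; have yt' := young_sort_columns yt.
have bt : all (fun r => size r <= n) t.
  apply/allP => r rt; rewrite -(size_iota 1 n) -(perm_size pt) size_flatten.
  rewrite (perm_sumn (perm_map _ (perm_to_rem rt))) /=.
  exact: leq_addr.
have bt' : all (fun r => size r <= n) (sort_columns t).
  by rewrite -(all_map size (fun m => m <= n)) shape_sort_columns all_map.
have pt' : perm_eq (flatten (sort_columns t)) (iota 1 n).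
  apply: perm_trans pt; apply/allP => x _ /=; apply/eqP.
  rewrite !(count_columns x (N := n)) //; apply: eq_big_nat => k /andP[k0 _].
  by rewrite column_sort_columns // count_sort.
apply/and5P; split=> //.
- apply: contra t0 => /(map_f size); rewrite shape_sort_columns /= => /mapP[r rt].
  by move/esym/size0nil=> r0; rewrite -r0.
- apply/(all_nthP [::]) => a; rewrite size_sort_columns => lta.
  have sza : size (nth [::] (sort_columns t) a) = size (nth [::] t a).
    have := congr1 (fun s => nth 0 s a) (shape_sort_columns t).
    by rewrite !(nth_map [::]) ?size_sort_columns.
  apply/(sortedP 0) => i; rewrite sza => lti.
  rewrite -[i.+1]/(i.+2.-1) -[X in nth 0 _ X]/(i.+1.-1).
  rewrite !nth_sort_columns ?lti ?(ltnW lti) //.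
  have ss k := sort_sorted leq_total (column k t).
  apply: (sorted_count_lt (ss _)); rewrite count_sort.
  apply: leq_trans (count_column_shift _ _ st) => //.
  rewrite -(count_sort leq); apply: sorted_count_le => //.
  by rewrite size_sort ltn_size_column.
- apply/allP => k kn; have := kn; rewrite mem_iota => /andP[k0 _]; rewrite column_sort_columns //.
  rewrite ltn_sorted_uniq_leq sort_sorted ?andbT; last exact: leq_total.
  rewrite sort_uniq; apply: count_mem_uniq => x.
  have ut : uniq (flatten t) by rewrite (perm_uniq pt) iota_uniq.
  have : count_mem x (column k t) <= 1.
    apply: (@leq_trans (count_mem x (flatten t))).
      rewrite (count_columns x bt) (bigD1_seq k) ?leq_addr ?iota_uniq //.
      by rewrite /index_iota subSS subn0.
    by rewrite count_uniq_mem // leq_b1.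
  by rewrite -has_pred1 has_count; case: (count_mem _ _) => [|[]].
Qed.

Definition pack_filling n (t : filling) : bfilling n :=
  insub_bseq n [seq insub_bseq n [seq (inord x : 'I_n.+1) | x <- r] | r <- t].

Lemma syt_entries n t : is_syt n t -> forall r, r \in t -> forall x, x \in r -> 1 <= x <= n.
Proof.
case/and5P=> _ _ pt _ _ r rt x xr.
have : x \in flatten t by apply/flattenP; exists r.
by rewrite (perm_mem pt) mem_iota add1n ltnS.
Qed.

Lemma syt_bounds n t : is_syt n t -> size t <= n /\ forall r, r \in t -> size r <= n.
Proof.
case/and5P=> t0 _ pt _ _; have <- : sumn (shape t) = n.
  by rewrite -size_flatten (perm_size pt) size_iota.
elim: t t0 {pt} => //= r t IHt; rewrite inE negb_or => /andP[r0 /IHt[lt1 lt2]].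
have {}r0 : 0 < size r by case: r r0.
split=> [|s]; first by rewrite -add1n leq_add.
by rewrite inE => /predU1P[->|/lt2]; [exact: leq_addr | move/leq_trans; apply; exact: leq_addl].
Qed.

Lemma pack_fillingK n t : is_syt n t -> rows_of_bfilling (pack_filling n t) = t.
Proof.
move=> st; have [szt szr] := syt_bounds st.
rewrite /rows_of_bfilling /pack_filling /insub_bseq insubdK ?unfold_in ?size_map //.
rewrite -map_comp -[RHS]map_id; apply/eq_in_map => r rt /=.
rewrite insubdK ?unfold_in ?size_map ?szr // -map_comp -[RHS]map_id.
apply/eq_in_map => x xr /=; rewrite inordK // ltnS.
by case/andP: (syt_entries st rt xr).
Qed.

Definition SYT_of n t (st : is_syt n t) : SYT n :=
  exist _ (pack_filling n t) (eq_ind_r (is_syt n) st (pack_fillingK st)).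

Lemma flatten_unnil t : flatten (unnil t) = flatten t.
Proof. by elim: t => //= -[|x r] t /= ->. Qed.

Lemma mem_elements n (b : {set 'I_n.+1}) (i : 'I_n.+1) : (nat_of_ord i \in elements b) = (i \in b).
Proof. by rewrite mem_sort (mem_map val_inj) mem_enum. Qed.

Lemma sorted_elements n (b : {set 'I_n.+1}) : sorted ltn (elements b).
Proof.
rewrite ltn_sorted_uniq_leq sort_uniq (map_inj_uniq val_inj) enum_uniq.
exact: sort_sorted leq_total _.
Qed.

Lemma phi_rows_syt n (p : OWP n) : is_syt n (phi_rows p).
Proof.
have /and4P[/forallP disj /eqP cov _ _] := valP p.
set t := unnil [seq elements (blocks p i) | i <- enum 'I_n.+1].
have pt : perm_eq (sort_rows t) t by rewrite perm_sort.
apply: sort_columns_syt.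
- by rewrite (perm_mem pt) mem_filter.
- rewrite /young sorted_map; apply: sort_sorted => r s; exact: leq_total.
- apply: perm_trans (perm_flatten pt) _; rewrite flatten_unnil.
  apply: uniq_perm; rewrite ?iota_uniq //.
    elim: (enum _) (enum_uniq 'I_n.+1) => //= i s IHs /andP[si /IHs us].
    rewrite cat_uniq (sorted_uniq ltn_trans ltnn (sorted_elements _)) us andbT /=.
    apply/hasPn => x /flatten_mapP[j js]; rewrite !mem_sort => /mapP[y].
    rewrite mem_enum => yj ->; rewrite /= (mem_map val_inj) mem_enum.
    have /forallP/(_ j)/implyP := disj i; rewrite disjoint_sym => dij.
    have nij : i != j by apply: contraNneq si => ->.
    by rewrite (disjointFr (dij nij) yj).
  move=> x; apply/flatten_mapP/idP => [[i _]|].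
    rewrite mem_sort => /mapP[y]; rewrite mem_enum => yi ->.
    have : y \in \bigcup_i val p i by apply/bigcupP; exists i.
    by rewrite cov inE mem_iota add1n ltn_ord => ->.
  rewrite mem_iota add1n => /andP[x0 ltx].
  have : Ordinal ltx \in \bigcup_i val p i by rewrite cov inE.
  by case/bigcupP=> i _ xi; exists i; rewrite ?mem_enum // (mem_elements _ (Ordinal ltx)).
- rewrite (perm_all _ pt) all_filter; apply/allP => r /mapP[i _ ->] /=.
  by rewrite sorted_elements implybT.
Qed.

Definition phi n (p : OWP n) : SYT n := SYT_of (phi_rows_syt p).

Lemma phiE n (p : OWP n) : phi p = phi_rows p :> filling.
Proof. exact: pack_fillingK (phi_rows_syt p). Qed.

Definition fiber n (T : SYT n) : {set OWP n} := [set p | phi p == T].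

Local Open Scope ring_scope.

(* Meant for an open set U: the iterated derivatives at points of U then only *)
(* depend on the values of c on U.                                            *)
Definition smooth_on (R : realType) (U : set R) (c : R -> R) : Prop :=
  forall (k : nat) (x : R), U x -> derivable (derive1n k c) x 1.

Definition cD (R : realType) (c f : R -> R) : R -> R := fun x => c x * derive1 f x.

(* Main.v *)
Require Import Defs.
From mathcomp Require Import all_boot all_order all_algebra.
From mathcomp Require Import all_classical all_reals all_analysis.
From mathcomp Require Import zify.
Import numFieldNormedType.Exports.

Set Implicit Arguments.
Unset Strict Implicit.
Unset Printing Implicit Defensive.

(** An ordered weak set partition is the same thing as a word: letter number
    x is the index of the block that contains x, and the two conditions on the
    blocks say exactly that this index is smaller than x ([perm_words]).  Call
    rank of x the position of x in its block, counted from 1.  Since [phi]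
    only permutes entries inside columns, x lies in column k of the tableau
    exactly when its rank is k ([colword_phi]).  A standard tableau is
    determined by its column word, the sequence of the columns of 1, ..., n
    ([colword_inj]), so the fiber of T is in bijection with the words whose
    sequence of ranks is the column word of T ([phi_ranks]).

    Such words are counted by adding one letter at a time ([sum_ranks]).  If
    the new letter n+1 must get rank 1, its block is any of the n+1 available
    blocks that are still empty; if it must get rank k+1, its block is any of
    those of size exactly k.  The number of blocks of size at least k is the
    number of earlier letters of rank k ([count_ranks]), hence can be read off
    the column word, and the number of choices is [sigma].

    For the differential operator, (cD)^n c is the sum, over the same words,
    of the product over all blocks B_0, ..., B_n of the derivative of c of
    order #|B_j| ([iter_cD]): by the product rule, applying D adds the new
    element n+1 to one of the blocks, and multiplying by c creates a new empty
    block.  Grouping the words by their tableau T gives the expansion, because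
    the nonempty blocks have the row lengths of T as sizes ([prod_sizes]). *)

(** * Words and their ranks *)

Lemma iotaSr m n : iota m n.+1 = rcons (iota m n) (m + n).
Proof. by rewrite -addn1 iotaD cats1. Qed.

Lemma count_mem_rcons (s : seq nat) j k :
  count_mem k (rcons s j) = count_mem k s + (j == k).
Proof. by rewrite -cats1 count_cat /= addn0. Qed.

(** Letters are indexed from 0: the letter at index i belongs to the element
    i+1 of the partition, and is at most i. *)
Fixpoint words n : seq (seq nat) :=
  if n is m.+1 then [seq rcons w j | w <- words m, j <- iota 0 m.+1]
  else [:: [::]].

Lemma mem_words n w :
  (w \in words n) = (size w == n) && all (fun i => nth 0 w i <= i) (iota 0 n).
Proof.
elim: n w => [|n IHn] w; first by case: w.
case: (lastP w) => [|v j].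
  by apply/negP => /allpairsP[[u i] [_ _ /(congr1 size)]]; rewrite size_rcons.
rewrite size_rcons eqSS iotaSr all_rcons add0n.
transitivity ((v \in words n) && (j <= n)).
  apply/allpairsP/andP => [[[u i] [uw]]|[vw jn]].
    by rewrite mem_iota => /andP[_ ltin] /rcons_inj[-> ->].
  by exists (v, j); split; rewrite // mem_iota.
rewrite IHn; case: eqP => //= szv; rewrite nth_rcons szv ltnn eqxx andbC.
congr (_ && _); apply: eq_in_all => i; rewrite mem_iota => /= lti.
by rewrite nth_rcons szv lti.
Qed.

Lemma words_uniq n : uniq (words n).
Proof.
elim: n => // n IHn; apply: allpairs_uniq; rewrite ?iota_uniq //.
by case=> u i [v j] _ _ /= /rcons_inj[-> ->].
Qed.

Lemma size_words n w : w \in words n -> size w = n.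
Proof. by rewrite mem_words => /andP[/eqP]. Qed.

Lemma words_lt n w : w \in words n -> all (gtn n) w.
Proof.
rewrite mem_words => /andP[/eqP sw /allP le_w]; apply/(all_nthP 0) => i.
rewrite sw => lti /=; apply: leq_ltn_trans (lti).
by apply: le_w; rewrite mem_iota.
Qed.

Definition ranks (w : seq nat) : seq nat :=
  [seq count_mem (nth 0 w i) (take i.+1 w) | i <- iota 0 (size w)].

Lemma size_ranks w : size (ranks w) = size w.
Proof. by rewrite size_map size_iota. Qed.

Lemma ranks_rcons w j : ranks (rcons w j) = rcons (ranks w) (count_mem j w).+1.
Proof.
rewrite /ranks size_rcons iotaSr add0n map_rcons nth_rcons ltnn eqxx.
rewrite take_oversize ?size_rcons // count_mem_rcons eqxx addn1.
rewrite -[rcons w j]cats1.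
congr rcons; apply/eq_in_map => i; rewrite mem_iota => /= lti.
by rewrite nth_cat lti takel_cat.
Qed.

Lemma count_bigsum (T : Type) (a : pred T) s : count a s = \sum_(i <- s) a i.
Proof. by rewrite -sum1_count big_mkcond; apply: eq_bigr => i _; case: (a i). Qed.

(** A letter occurring m times contributes the ranks 1, ..., m, each once, so the
    letters occurring at least k times correspond to the ranks equal to k. *)
Lemma count_ranks N w k : all (gtn N) w -> 0 < k ->
  count (fun j => k <= count_mem j w) (iota 0 N) = count_mem k (ranks w).
Proof.
move=> + k0; elim/last_ind: w => [_|w j IHw].
  by rewrite (@eq_count _ _ pred0) ?count_pred0 // => j /=; rewrite leqNgt k0.
rewrite all_rcons => /andP[/= ltj /IHw{}IHw].
rewrite ranks_rcons count_mem_rcons -{}IHw.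
rewrite !(count_bigsum (fun j => k <= _)).
have -> : nat_of_bool ((count_mem j w).+1 == k)
    = \sum_(i <- iota 0 N) ((i == j) && ((count_mem j w).+1 == k)).
  rewrite (bigD1_seq j) ?iota_uniq ?mem_iota //= eqxx big1 ?addn0 //.
  by move=> i /negPf->.
rewrite -big_split /=.
apply: eq_bigr => i _; rewrite count_mem_rcons eq_sym.
case: eqP => [->|_]; last by rewrite !addn0.
by rewrite /=; lia.
Qed.

(** The number [sigma] of the element i+1, read off the column word; [sigma_colword]
    is the comparison. *)
Definition sigma_word (cw : seq nat) i : nat :=
  let k := nth 0 cw i in let pre := take i.+1 cw in
  if k == 1 then i.+1 - count_mem 1 pre + 1
  else count_mem k.-1 pre - count_mem k pre + 1.

(** The Yamanouchi condition, which holds for column words of tableaux because each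
    [restrict i T] is again a Young shape.  It makes the truncated subtractions of
    [sigma_word] harmless. *)
Definition yamanouchi (cw : seq nat) : Prop :=
  forall i k, 0 < k -> count_mem k.+1 (take i cw) <= count_mem k (take i cw).

Lemma sigma_word_rcons cw k i : i < size cw -> sigma_word (rcons cw k) i = sigma_word cw i.
Proof. by move=> lti; rewrite /sigma_word -cats1 nth_cat lti takel_cat. Qed.

(** Rank k = 1 is given by the unused letters, and rank k > 1 by the letters used
    exactly k - 1 times, which are those used at least k - 1 times minus those used
    at least k times.  The +1 in [sigma_word] compensates for the last entry k, which is
    already counted there. *)
Lemma count_letters_of_rank n w k : w \in words n -> 0 < k ->
  (forall l, 0 < l -> count_mem l.+1 (rcons (ranks w) k) <= count_mem l (rcons (ranks w) k)) ->
  count (fun j => (count_mem j w).+1 == k) (iota 0 n.+1) = sigma_word (rcons (ranks w) k) n.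
Proof.
move=> wn k0 latk; have sw := size_words wn.
have ltw : all (gtn n.+1) w.
  by apply: sub_all (words_lt wn) => j; exact: ltnW.
rewrite /sigma_word nth_rcons size_ranks sw ltnn eqxx take_oversize ?size_rcons ?size_ranks ?sw //.
case: eqP => [k1|k1].
  have := count_predC (fun j => 1 <= count_mem j w) (iota 0 n.+1).
  rewrite (count_ranks ltw) // size_iota.
  rewrite (@eq_count _ (predC _) (fun j => (count_mem j w).+1 == 1)); last first.
    by move=> j /=; rewrite eqSS -leqNgt leqn0.
  have := count_size (pred1 1) (ranks w); rewrite size_ranks sw => le1.
  by rewrite k1 count_mem_rcons eqxx; lia.
case: k k0 k1 latk => // -[//|l] _ _ latk.
rewrite [l.+2.-1]/=.
have E : count (fun j => (count_mem j w).+1 == l.+2) (iota 0 n.+1) + count_mem l.+2 (ranks w)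
   = count_mem l.+1 (ranks w).
  rewrite -!(count_ranks ltw) //.
  rewrite -count_predUI (@eq_count _ (predI _ _) pred0) ?count_pred0 ?addn0.
    by apply: eq_count => j /=; lia.
  by move=> j /=; lia.
have := latk l.+1 isT; rewrite !count_mem_rcons !eqxx.
have -> : (l.+2 == l.+1) = false by lia.
lia.
Qed.

(** The number of ways to extend a word so that the new letter gets a given rank only
    depends on the ranks of the word, so the count is a product. *)
Lemma sum_ranks cw : all (leq 1) cw -> yamanouchi cw ->
  \sum_(w <- words (size cw)) (ranks w == cw) = \prod_(i < size cw) sigma_word cw i.
Proof.
elim/last_ind: cw => [|cw k IHcw]; first by rewrite big_seq1 big_ord0.
rewrite all_rcons => /andP[k0 cw0] latk; rewrite size_rcons big_ord_recr.
have lat : yamanouchi cw.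
  move=> i l l0; case: (leqP i (size cw)) => [lei|/ltnW gei].
    by have := latk i l l0; rewrite -cats1 takel_cat.
  have := latk (size cw) l l0.
  by rewrite -cats1 takel_cat // take_size take_oversize.
rewrite (eq_bigr (fun i : 'I_(size cw) => sigma_word cw i)); last first.
  by move=> i _; rewrite sigma_word_rcons //=.
rewrite -IHcw // big_allpairs_dep /= big_distrl /=.
rewrite big_seq [RHS]big_seq; apply: eq_bigr => w wn.
under eq_bigr => j _ do rewrite ranks_rcons eqseq_rcons.
case: (ranks w =P cw) => [rw|]; last by rewrite big1.
rewrite mul1n; have := count_letters_of_rank wn k0; rewrite rw => <-.
  by rewrite count_bigsum.
move=> l l0; have := latk (size cw).+1 l l0.
by rewrite take_oversize ?size_rcons.
Qed.

(** * Column words of tableaux *)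

Lemma column_flatten k t x : 0 < k -> x \in column k t -> x \in flatten t.
Proof.
case: k => // k _; case/mapP => r; rewrite mem_filter => /andP[ltk rt] ->.
by apply/flattenP; exists r => //; apply: mem_nth.
Qed.

Lemma mem_column x k t : uniq (flatten t) -> x \in flatten t -> 0 < k ->
  (x \in column k t) = (column_of x t == k).
Proof.
move=> + + k0; elim: t => //= r t IHt; rewrite cat_uniq mem_cat => /and3P[ur /hasPn rt ut].
rewrite column_cons mem_cat /column_of /=.
have [xr _|xr /= xt] := boolP (x \in r); last first.
  rewrite [X in X || _](_ : _ = false) ?IHt //.
  case: ifP => // ler; rewrite inE; apply: contraNF xr => /eqP->.
  by apply: mem_nth; case: (k) k0 ler.
rewrite [X in _ || X](_ : _ = false) ?orbF; last first.
  by apply/negP => /(column_flatten k0)/rt/negP; apply.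
case: k k0 IHt => // k _ _; rewrite eqSS /=; case: ltnP => ltk.
  rewrite inE; apply/eqP/eqP => [->|<-]; first by rewrite index_uniq.
  by rewrite nth_index.
by apply/esym/eqP => E; move: ltk; rewrite -E leqNgt index_mem xr.
Qed.

Lemma column_uniq k t : 0 < k -> uniq (flatten t) -> uniq (column k t).
Proof.
move=> k0; elim: t => //= r t IHt; rewrite cat_uniq => /and3P[ur /hasPn rt /IHt ut].
rewrite column_cons; case: ifP => // ler; rewrite /= ut andbT.
apply/negP => /(column_flatten k0)/rt/negP; apply.
by apply: mem_nth; case: (k) k0 ler.
Qed.

Definition colword n t : seq nat := [seq column_of x t | x <- iota 1 n].

Lemma size_colword n t : size (colword n t) = n.
Proof. by rewrite size_map size_iota. Qed.

Lemma syt_uniq n t : is_syt n t -> uniq (flatten t).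
Proof. by case/and5P=> _ _ pt _ _; rewrite (perm_uniq pt) iota_uniq. Qed.

Lemma syt_mem n t x : is_syt n t -> (x \in flatten t) = (0 < x <= n).
Proof. by case/and5P=> _ _ pt _ _; rewrite (perm_mem pt) mem_iota add1n ltnS. Qed.

Lemma count_column n t i k : is_syt n t -> i <= n -> 0 < k ->
  count (fun y => y <= i) (column k t) = count_mem k (take i (colword n t)).
Proof.
move=> st lein k0; rewrite /colword -map_take take_iota (minn_idPl lein) [RHS]count_map.
rewrite -!size_filter; apply: perm_size; apply: uniq_perm.
- by rewrite filter_uniq // column_uniq // (syt_uniq st).
- by rewrite filter_uniq // iota_uniq.
move=> y; rewrite !mem_filter mem_iota add1n ltnS /=.
case: (leqP y i) => [leyi|]; last by rewrite !andbF.
case: (posnP y) => [y0|y0].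
  rewrite andbF; apply/negP => /(column_flatten k0).
  by rewrite (syt_mem _ st) y0.
rewrite (mem_column (syt_uniq st)) ?andbT ?(syt_mem _ st) //.
by rewrite y0 (leq_trans leyi).
Qed.

(** An entry at most i in column k+1 has a smaller entry to its left, in column k. *)
Lemma yamanouchi_colword n t : is_syt n t -> yamanouchi (colword n t).
Proof.
move=> st i k k0; wlog lein : i / i <= n => [hwlog|].
  case: (leqP i n) => [/hwlog //|/ltnW lein].
  rewrite take_oversize ?size_colword // -{1 2}(take_size (colword n t)).
  by rewrite size_colword; apply: hwlog.
rewrite -!(count_column st) //.
have /and5P[_ _ _ rt _] := st.
apply: leq_trans (count_column_shift _ k0 rt) _.
by apply: sub_count => y; apply: ltnW.
Qed.

Lemma size_filter_le r i k : sorted ltn r -> 0 < k ->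
  (k <= size [seq x <- r | x <= i]) = (k <= size r) && (nth 0 r k.-1 <= i).
Proof.
move=> sr; have sr' : sorted leq r by apply: sub_sorted sr => x y /ltnW.
case: k => // k _; rewrite size_filter.
apply/idP/andP => [ltk|[ltk le_i]].
  split; first exact: leq_trans ltk (count_size _ _).
  exact: (@sorted_count_lt _ _ i.+1).
apply: leq_trans (sorted_count_le sr' ltk) _.
by apply: sub_count => y /leq_trans; apply.
Qed.

Lemma col_restrict i t k : all (sorted ltn) t -> 0 < k ->
  Defs.col k (Defs.restrict i t) = count (fun y => y <= i) (column k t).
Proof.
move=> rt k0; rewrite /Defs.col size_column /Defs.restrict /unnil count_filter count_map.
elim: t rt => //= r t IHt /andP[sr /IHt->]; rewrite column_cons count_cat.
congr (_ + _); transitivity (nat_of_bool (k <= size [seq x <- r | x <= i])).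
  by rewrite /=; case: [seq x <- r | x <= i] => /= [|_ l]; rewrite ?andbT //; case: (k) k0.
by rewrite size_filter_le //; case: ifP => //=; rewrite addn0.
Qed.

Lemma sigma_colword n t i : is_syt n t -> i < n -> sigma i.+1 t = sigma_word (colword n t) i.
Proof.
move=> st ltin; have /and5P[_ _ _ rt _] := st.
rewrite /sigma /sigma_word (nth_map 0) ?size_iota // nth_iota // add1n.
have c0 : 0 < column_of i.+1 t by [].
case: eqP => [_|c1]; first by rewrite col_restrict // (count_column st).
have c1' : 0 < (column_of i.+1 t).-1 by move: c0 c1; case: column_of => [|[]].
by rewrite !col_restrict // !(count_column st).
Qed.

Lemma colword_gt0 n t : all (leq 1) (colword n t).
Proof. by rewrite all_map; apply/allP. Qed.

(** The column word gives the set of entries of each column, and columns increase;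
    the columns, stacked from the bottom, determine the rows. *)
Lemma colword_inj n t t' : is_syt n t -> is_syt n t' ->
  colword n t = colword n t' -> t = t'.
Proof.
move=> st st' E.
have colE k : 0 < k -> column k t = column k t'.
  move=> k0; case: (leqP k n) => [lekn|ltnk]; last first.
    have no_col u : is_syt n u -> column k u = [::].
      move=> su; apply/nilP; rewrite /nilp size_column -leqn0 leqNgt -has_count.
      apply/hasPn => r ru; rewrite -ltnNge.
      by apply: leq_ltn_trans ltnk; apply: (syt_bounds su).2.
    by rewrite !no_col.
  have ss u : is_syt n u -> sorted ltn (column k u).
    by case/and5P=> _ _ _ _ /allP; apply; rewrite mem_iota k0 add1n ltnS.
  apply: (irr_sorted_eq ltn_trans ltnn (ss _ st) (ss _ st')) => x.
  case: (boolP (x \in flatten t)) => xt; last first.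
    apply/idP/idP => /(column_flatten k0); first by rewrite (negPf xt).
    by rewrite (syt_mem _ st') -(syt_mem _ st) (negPf xt).
  have := xt; rewrite (syt_mem _ st) => xn; rewrite !mem_column ?(syt_uniq st) ?(syt_uniq st') //.
    move/eq_in_map: E => /(_ x)->//.
    by rewrite mem_iota add1n ltnS.
  by rewrite (syt_mem _ st').
have nonnil u : is_syt n u -> all (fun r => 1 <= size r) u.
  case/and5P=> u0 _ _ _ _; apply/allP => -[|//] ru.
  by rewrite ru in u0.
have sizeE : size t = size t'.
  have := congr1 size (colE 1 isT); rewrite !size_column.
  by have := nonnil _ st; have := nonnil _ st'; rewrite !all_count => /eqP-> /eqP->.
have /and5P[_ yt _ _ _] := st; have /and5P[_ yt' _ _ _] := st'.
apply: (@eq_from_nth _ [::]) => // a lta.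
have lta' : a < size t' by rewrite -sizeE.
have rsize k : (k.+1 <= size (nth [::] t a)) = (k.+1 <= size (nth [::] t' a)).
  by rewrite -!ltn_size_column // colE.
have szE : size (nth [::] t a) = size (nth [::] t' a).
  by apply/eqP; rewrite eqn_leq leqNgt rsize ltnn leqNgt -rsize ltnn.
apply: (@eq_from_nth _ 0) => // b ltb.
have ltab : a < size (column b.+1 t) by rewrite ltn_size_column.
have ltab' : a < size (column b.+1 t') by rewrite -colE.
have := nth_column yt ltab; have := nth_column yt' ltab'.
by rewrite colE //= => -> ->.
Qed.

Lemma rows_of_bfilling_inj n : injective (@rows_of_bfilling n).
Proof.
move=> t t' E; apply: val_inj; apply: inj_map E => r r' E.
by apply: val_inj; apply: inj_map E; apply: val_inj.
Qed.

Lemma syt_rows_syt n (T : SYT n) : is_syt n T.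
Proof. exact: valP T. Qed.

Lemma syt_rows_inj n : injective (@syt_rows n).
Proof. by move=> T T' /rows_of_bfilling_inj/val_inj. Qed.

(** * Set partitions as words *)

(** The default [ord0] is never reached for 1 <= x <= n, as the blocks cover [n]. *)
Definition letter n (p : OWP n) x : nat :=
  odflt ord0 [pick j | inord x \in blocks p j].

Definition word n (p : OWP n) : seq nat := [seq letter p x | x <- iota 1 n].

Lemma size_word n (p : OWP n) : size (word p) = n.
Proof. by rewrite size_map size_iota. Qed.

Lemma mem_block n (p : OWP n) (x j : 'I_n.+1) :
  (x \in blocks p j) = (0 < x) && (nth 0 (word p) x.-1 == j).
Proof.
have /and4P[/forallP disj /eqP cov _ _] := valP p.
have -> : (0 < x) = (x \in \bigcup_i blocks p i) by rewrite cov inE.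
have [xp|/bigcupP xp] := boolP (x \in \bigcup_i blocks p i); last first.
  by apply/negP => xj; apply: xp; exists j.
have x0 : 0 < x by move: xp; rewrite cov inE.
have -> : nth 0 (word p) x.-1 = letter p x.
  have ltx : x.-1 < n by rewrite prednK // -ltnS.
  by rewrite (nth_map 0) ?size_iota // nth_iota // add1n prednK.
rewrite /letter inord_val; case: pickP => [i xi|no_i]; last first.
  by case/bigcupP: xp => i _; have /= -> := no_i i.
apply/idP/eqP => [xj|/val_inj<- //].
congr nat_of_ord; apply/eqP; apply: contraT => nij.
by have /forallP/(_ j)/implyP/(_ nij)/disjointFr/(_ xi) := disj i; rewrite xj.
Qed.

Lemma word_words n (p : OWP n) : word p \in words n.
Proof.
rewrite mem_words size_word eqxx; apply/allP => i; rewrite mem_iota => /= ltin.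
have /and4P[_ /eqP cov _ /forallP lowp] := valP p.
have lti : i.+1 < n.+1 by [].
have : Ordinal lti \in \bigcup_i blocks p i by rewrite cov inE.
case/bigcupP => j _ xj; have := xj; rewrite mem_block /= => /eqP->.
case: (posnP j) => [->//|j0].
by have /implyP/(_ j0)/forall_inP/(_ _ xj) := lowp j.
Qed.

Lemma word_inj n : injective (@word n).
Proof.
move=> p q E; apply: val_inj; apply/ffunP => j; apply/setP => x.
by rewrite -/(blocks p) -/(blocks q) !mem_block E.
Qed.

Definition blocks_of_word n (w : seq nat) : {ffun 'I_n.+1 -> {set 'I_n.+1}} :=
  [ffun j : 'I_n.+1 => [set x : 'I_n.+1 | (0 < x) && (nth 0 w x.-1 == j)]].

(** For n = 0 the only word is the empty one, but no block contains 1. *)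
Lemma blocks_of_word_owp n w : 0 < n -> w \in words n -> is_owp (blocks_of_word n w).
Proof.
move=> n0; rewrite mem_words => /andP[/eqP sw /allP lew].
have lew' (x : 'I_n.+1) : 0 < x -> nth 0 w x.-1 < x.
  by move=> x0; rewrite -[ltnRHS](prednK x0) ltnS lew // mem_iota /= prednK // -ltnS.
apply/and4P; split.
- apply/forallP => i; apply/forallP => j; apply/implyP => nij.
  rewrite disjoint_subset; apply/fintype.subsetP => x; rewrite !ffunE !inE => /andP[-> /eqP->].
  exact: nij.
- apply/eqP/setP => x; rewrite inE; apply/bigcupP/idP => [[j _]|x0].
    by rewrite ffunE inE => /andP[].
  have ltx : nth 0 w x.-1 < n.+1 by apply: ltn_trans (lew' _ x0) (ltn_ord x).
  by exists (Ordinal ltx); rewrite // ffunE inE x0 /=.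
- have lt1 : 1 < n.+1 by [].
  rewrite -[1]/(nat_of_ord (Ordinal lt1)) mem_elements ffunE inE /=.
  by have := lew' (Ordinal lt1) isT; rewrite /= ltnS leqn0.
- apply/forallP => i; apply/implyP => i0; apply/forall_inP => x.
  by rewrite ffunE inE => /andP[x0 /eqP<-]; apply: lew'.
Qed.

Lemma perm_words n : 0 < n ->
  perm_eq [seq word p | p <- index_enum (OWP n)] (words n).
Proof.
move=> n0; apply: uniq_perm.
- by rewrite (map_inj_uniq (@word_inj n)) index_enum_uniq.
- exact: words_uniq.
move=> w; apply/mapP/idP => [[p _ ->]|wn]; first exact: word_words.
pose p : OWP n := exist (fun B => is_owp B) _ (blocks_of_word_owp n0 wn).
exists p; first exact: mem_index_enum.
apply: (@eq_from_nth _ 0); first by rewrite size_word (size_words wn).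
move=> i; rewrite (size_words wn) => ltin.
have lti : i.+1 < n.+1 by [].
have ltw : nth 0 w i < n.+1.
  by apply: ltnW; move/allP: (words_lt wn); apply; rewrite mem_nth ?(size_words wn).
have := mem_block p (Ordinal lti) (Ordinal ltw).
by rewrite /blocks /= ffunE inE /= eqxx => /esym/eqP.
Qed.

(** * The map phi on words *)

Lemma count_take w i j : i <= size w ->
  count (fun y => nth 0 w y.-1 == j) (iota 1 i) = count_mem j (take i w).
Proof.
move=> lei; rewrite -(map_nth_iota0 0 lei) count_map -[1]/(1 + 0) iotaDl count_map.
exact: eq_count.
Qed.

Lemma elements_block n (p : OWP n) (j : 'I_n.+1) :
  elements (blocks p j) = [seq x <- iota 1 n | nth 0 (word p) x.-1 == j].
Proof.
apply: (irr_sorted_eq ltn_trans ltnn (sorted_elements _)).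
  by apply: sorted_filter; [exact: ltn_trans | exact: iota_ltn_sorted].
move=> x; rewrite mem_filter mem_iota add1n; case: (ltnP x n.+1) => ltx.
  by rewrite (mem_elements _ (Ordinal ltx)) mem_block andbT andbC.
rewrite !andbF; apply/negP; rewrite mem_sort => /mapP[y _ xy].
by move: ltx; rewrite xy leqNgt ltn_ord.
Qed.

Lemma size_elements n (p : OWP n) (j : 'I_n.+1) :
  size (elements (blocks p j)) = count_mem (j : nat) (word p).
Proof.
by rewrite elements_block size_filter count_take ?size_word // take_oversize ?size_word.
Qed.

(** Blocks are listed increasingly, so before sorting x stands in column k exactly when
    its rank is k; sorting the rows and then each column leaves the set of entries of
    every column unchanged. *)
Lemma colword_phi n (p : OWP n) : colword n (phi_rows p) = ranks (word p).
Proof.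
have st := phi_rows_syt p; set w := word p; have sw : size w = n := size_word p.
apply: (@eq_from_nth _ 0); rewrite size_colword ?size_ranks //.
move=> i ltin; rewrite [LHS](nth_map 0) ?size_iota // [RHS](nth_map 0) ?size_iota ?sw //.
rewrite !nth_iota ?sw // add0n add1n.
have ltw : nth 0 w i < n.+1.
  apply: ltnW; move/allP: (words_lt (word_words p)); apply.
  by rewrite mem_nth ?sw.
set j := Ordinal ltw; set k := count_mem _ _.
have kE : k = (count_mem (nth 0 w i) (take i w)).+1.
  by rewrite /k (take_nth 0) ?sw // count_mem_rcons eqxx addn1.
have k0 : 0 < k by rewrite kE.
apply/eqP; rewrite -(mem_column (syt_uniq st)) ?(syt_mem _ st) //.
rewrite column_sort_columns ?mem_sort //; last first.
  by rewrite /young sorted_map; apply: sort_sorted => r s; exact: leq_total.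
(* The block of i+1, cut at its element i+1. *)
pose r1 := [seq x <- iota 1 i | nth 0 w x.-1 == j].
pose r2 := [seq x <- iota i.+2 (n - i.+1) | nth 0 w x.-1 == j].
have rE : elements (blocks p j) = r1 ++ i.+1 :: r2.
  have iE : iota 1 n = iota 1 i ++ i.+1 :: iota i.+2 (n - i.+1).
    by rewrite -[n in LHS](subnKC ltin) addSnnS iotaD.
  by rewrite elements_block -/w iE filter_cat /= eqxx.
have sr1 : size r1 = k.-1 by rewrite size_filter count_take ?sw ?kE // ltnW.
apply/mapP; exists (elements (blocks p j)).
  rewrite mem_filter mem_sort mem_filter.
  rewrite (map_f (fun i => elements (blocks p i))) ?mem_enum // andbT.
  by rewrite rE size_cat sr1 /= addnS -addSn prednK // leq_addr; case: (r1).
by rewrite rE nth_cat sr1 ltnn subnn.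
Qed.

Lemma phi_ranks n (p : OWP n) (T : SYT n) :
  (phi p == T) = (ranks (word p) == colword n T).
Proof.
rewrite -colword_phi; apply/eqP/eqP => [<-|E]; first by rewrite phiE.
apply: syt_rows_inj; rewrite phiE.
by apply: colword_inj E; [exact: phi_rows_syt | exact: syt_rows_syt].
Qed.

Lemma card_fiber n (T : SYT n) : 0 < n ->
  #|fiber T| = \prod_(1 <= i < n.+1) sigma i T.
Proof.
move=> n0; rewrite -sum1_card big_mkcond.
rewrite (eq_bigr (fun p => (ranks (word p) == colword n T) : nat)); last first.
  by move=> p _; rewrite inE phi_ranks; case: eqP.
rewrite -(big_map (@word n) xpredT (fun w => (ranks w == colword n T) : nat)).
rewrite (perm_big _ (perm_words n0)) /=.
have := sum_ranks (colword_gt0 n T) (yamanouchi_colword (syt_rows_syt T)).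
rewrite size_colword => ->; rewrite big_add1 /= big_mkord; apply: eq_bigr => i _.
by rewrite (sigma_colword (syt_rows_syt T)).
Qed.

(** All blocks B_0, ..., B_n are listed, so empty ones contribute zeros, which account
    for the power of the underived function. *)
Definition block_sizes n (w : seq nat) : seq nat := [seq count_mem j w | j <- iota 0 n.+1].

Lemma shape_phi n (p : OWP n) :
  perm_eq [seq size r | r <- phi_rows p] [seq a <- block_sizes n (word p) | 0 < a].
Proof.
rewrite shape_sort_columns (perm_trans (perm_map _ (permEl (perm_sort _ _)))) //.
have -> : block_sizes n (word p)
    = [seq size r | r <- [seq elements (blocks p i) | i <- enum 'I_n.+1]].
  rewrite /block_sizes -val_enum_ord -!map_comp; apply: eq_map => i /=.
  by rewrite size_elements.
rewrite filter_map /unnil.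
by rewrite (@eq_filter _ (fun r => r != [::]) (preim size (leq 1))) //; case.
Qed.

Lemma prod_rows (R : comPzSemiRingType) n (g : nat -> R) (t : filling) :
  all (fun r => 0 < size r <= n) t ->
  (\prod_(r <- t) g (size r) = \prod_(1 <= i < n.+1) g i ^+ nrows_of_size i t)%R.
Proof.
elim: t => [_|r t IHt /= /andP[rn /IHt{}IHt]]; first by rewrite big_nil big1.
rewrite big_cons IHt /nrows_of_size /=.
under [RHS]eq_bigr do rewrite GRing.exprD.
rewrite big_split /=; congr (_ * _)%R.
rewrite (bigD1_seq (size r)) ?iota_uniq ?mem_index_iota ?ltnS //= eqxx GRing.expr1.
by rewrite big1 ?GRing.mulr1 // => i /negPf; rewrite eq_sym => ->.
Qed.

Lemma prod_sizes (R : comPzSemiRingType) n (g : nat -> R) (p : OWP n) (T : SYT n) :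
  phi p = T ->
  (\prod_(a <- block_sizes n (word p)) g a =
   g 0%N ^+ (n + 1 - nrows T) * \prod_(1 <= i < n.+1) g i ^+ nrows_of_size i T)%R.
Proof.
move=> <-; rewrite phiE; have st := phi_rows_syt p.
rewrite -prod_rows; last first.
  apply/allP => r rt; rewrite (syt_bounds st).2 // andbT lt0n.
  by case/and5P: st => t0 _ _ _ _; apply: contra t0 => /eqP/size0nil<-.
rewrite -(big_map size xpredT g) (perm_big _ (shape_phi p)) big_filter.
rewrite (bigID (leq 1)) /= GRing.mulrC; congr (_ * _)%R.
rewrite (eq_bigr (fun=> g 0%N)); last by case.
rewrite big_const_seq GRing.iter_mulr_1; congr (_ ^+ _)%R.
rewrite /nrows -(size_map size) (perm_size (shape_phi p)) size_filter.
have <- : size (block_sizes n (word p)) = n + 1 by rewrite size_map size_iota addn1.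
by rewrite -(count_predC (leq 1)) addKn.
Qed.

(** * The iterated operator *)

Local Open Scope ring_scope.

Lemma is_derive_big_sum (R : realType) (I : Type) (r : seq I) (f : I -> R -> R)
    (df : I -> R) (x : R) : (forall i, is_derive x 1 (f i) (df i)) ->
  is_derive x 1 (fun y => \sum_(i <- r) f i y) (\sum_(i <- r) df i).
Proof.
move=> fP; elim: r => [|i r IHr].
  rewrite big_nil [X in is_derive _ _ X](_ : _ = cst 0); first exact: is_derive_cst.
  by apply/funext => y; rewrite big_nil.
rewrite big_cons [X in is_derive _ _ X](_ : _ = f i + (fun y => \sum_(j <- r) f j y)).
  exact: is_deriveD.
by apply/funext => y; rewrite big_cons.
Qed.

(** The product rule for factors taken in a sequence g in which each function is the
    derivative of the previous one: differentiating raises one index by 1. *)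
Lemma is_derive_prod_family (R : realType) (g : nat -> R -> R) (x : R)
    (r : seq nat) (e : nat -> nat) :
  (forall k, is_derive x 1 (g k) (g k.+1 x)) -> uniq r ->
  is_derive x 1 (fun y => \prod_(i <- r) g (e i) y)
    (\sum_(j <- r) \prod_(i <- r) g (e i + (j == i))%N x).
Proof.
move=> gP; elim: r => [_|i r IHr /= /andP[ir /IHr{}IHr]].
  rewrite big_nil [X in is_derive _ _ X](_ : _ = cst 1); first exact: is_derive_cst.
  by apply/funext => y; rewrite big_nil.
rewrite [X in is_derive _ _ X](_ : _ = g (e i) * (fun y => \prod_(j <- r) g (e j) y)).
  apply: is_derive_eq (is_deriveM (gP _) IHr) _.
  rewrite big_cons GRing.addrC /GRing.scale /=; congr (_ + _).
    rewrite big_cons eqxx addn1 GRing.mulrC; congr (_ * _).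
    rewrite big_seq [RHS]big_seq; apply: eq_bigr => j jr.
    by case: eqP => [ij|_]; rewrite ?addn0 //; rewrite ij jr in ir.
  rewrite big_distrr /= big_seq [RHS]big_seq; apply: eq_bigr => j jr.
  rewrite big_cons; case: eqP => [ij|_]; rewrite ?addn0 //.
  by rewrite -ij jr in ir.
by apply/funext => y; rewrite big_cons.
Qed.

(** Passing from n to n+1, the term of a word w becomes the sum of the terms of the
    words [rcons w j], j <= n: the product rule raises the size of block j, and the
    new factor c is the contribution of the block n+1, which is still empty. *)
Lemma iter_cD (R : realType) (U : set R) (c : R -> R) n (x : R) :
  open U -> smooth_on U c -> U x ->
  iter n (cD c) c x = \sum_(w <- words n) \prod_(a <- block_sizes n w) derive1n a c x.
Proof.
move=> oU sc; elim: n x => [|n IHn] x Ux.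
  by rewrite big_seq1 /block_sizes /= big_seq1.
rewrite iterS /cD derive1E.
have gP k : is_derive x 1 (derive1n k c) (derive1n k.+1 c x).
  by apply: DeriveDef; [exact: sc | rewrite derive1nS derive1E].
(* The induction hypothesis is only valid on U, a neighborhood of x. *)
have E : \forall y \near x, \sum_(w <- words n) \prod_(j <- iota 0 n.+1)
    derive1n (count_mem j w) c y = iter n (cD c) c y.
  near=> y; rewrite IHn; last by near: y; exact: open_nbhs_nbhs.
  by apply: eq_bigr => w _; rewrite /block_sizes big_map.
rewrite -(near_eq_derive _ E).
have := is_derive_big_sum (words n) (fun w =>
  is_derive_prod_family (fun j => count_mem j w) gP (iota_uniq 0 n.+1)).
case=> _ ->; rewrite big_allpairs_dep big_distrr.
rewrite big_seq [RHS]big_seq; apply: eq_bigr => w wn.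
rewrite big_distrr big_seq [RHS]big_seq; apply: eq_bigr => j.
rewrite mem_iota add0n => /andP[_ ltj].
rewrite /block_sizes big_map (iotaSr 0 n.+1) [RHS]big_rcons /= count_mem_rcons [RHS]GRing.mulrC.
have -> : count_mem n.+1 w = 0%N.
  apply/eqP; rewrite -leqn0 leqNgt -has_count; apply/hasPn => i /(allP (words_lt wn)) /= lti.
  by rewrite ltn_eqF // ltnW.
rewrite ltn_eqF // addn0; congr (_ * _).
by apply: eq_bigr => i _; rewrite count_mem_rcons.
Unshelve. all: by end_near.
Qed.

Theorem theorem29 (n : nat) (hn : (1 <= n)%N) :
  (forall T : SYT n, #|fiber T| = (\prod_(1 <= i < n.+1) sigma i T)%N) /\
  (forall (R : realType) (U : set R) (c : R -> R), open U -> smooth_on U c ->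
     forall x : R, U x ->
       iter n (cD c) c x =
         \sum_(T : SYT n) #|fiber T|%:R * c x ^+ (n + 1 - nrows T) *
           \prod_(1 <= i < n.+1) derive1n i c x ^+ nrows_of_size i T /\
       \sum_(T : SYT n) #|fiber T|%:R * c x ^+ (n + 1 - nrows T) *
           \prod_(1 <= i < n.+1) derive1n i c x ^+ nrows_of_size i T =
         \sum_(T : SYT n)
           (\prod_(1 <= i < n.+1) ((sigma i T)%:R * derive1n i c x ^+ nrows_of_size i T)) *
           c x ^+ (n + 1 - nrows T)).
Proof.
split=> [T|R U c oU sc x Ux]; first exact: card_fiber.
split; last first.
  apply: eq_bigr => T _; rewrite card_fiber // GRing.natr_prod [in RHS]big_split /=.
  by rewrite GRing.mulrAC.
rewrite (iter_cD n oU sc Ux) -(perm_big _ (perm_words hn)) big_map.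
rewrite (partition_big (@phi n) xpredT) //=; apply: eq_bigr => T _.
rewrite (eq_bigr (fun=> c x ^+ (n + 1 - nrows (T : SYT n)) *
           \prod_(1 <= i < n.+1) derive1n i c x ^+ nrows_of_size i (T : SYT n))).
  rewrite -GRing.mulrA GRing.mulr_natl -GRing.sumr_const; apply: eq_bigl => p.
  by rewrite inE.
by move=> p /eqP/(prod_sizes (fun a => derive1n a c x)).
Qed.
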